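(* Let $\mathbb{C}$ be a pre-exact majority category. Then every object $X$ of $\mathbb{C}$ with global support is projection-coextensive.
   Context: A category is regular if it has finite limits, coequalizers of kernel pairs, and regular epimorphisms are stable under pullback. $X$ has global support if $X\to 1$ is a regular epimorphism. If coequalizers of equivalence relations exist, the effective closure $\overline{E}$ of an equivalence relation $E$ is the kernel equivalence relation of a coequalizer of $E$. A regular category is pre-exact if it admits coequalizers of equivalence relations and $\overline{E_1\cap E_2}=\overline{E_1}\cap\overline{E_2}$ for any two equivalence relations $E_1,E_2$ on the same object. A category $\mathbb{C}$ with finite products is a majority category if for every ternary internal relation $R$ (a subobject of $X\times Y\times Z$) and all morphisms $x,x':S\to X$, $y,y':S\to Y$, $z,z':S\to Z$: if $(x,y,z')$, $(x,y',z)$ and $(x',y,z)$ all factor through $R$, then $(x,y,z)$ factors through $R$. For a regular category this is equivalent to: for any three equivalence relations $A,B,C$ on any object, $A\cap(B\circ C)=(A\cap B)\circ(A\cap C)$, where $\circ$ is composition of relations. A product projection of $X$ is a morphism $X\to A$ that is one of the two legs of some binary product diagram $A\leftarrow X\to A'$. For a class $\mathcal{M}$ of morphisms, an $\mathcal{M}$-pushout is a pushout square whose two morphisms into the pushout object belong to $\mathcal{M}$. $X$ is $\mathcal{M}$-coextensive if every morphism in $\mathcal{M}$ with domain $X$ admits an $\mathcal{M}$-pushout along every product projection of $X$, and for every commutative diagram consisting of a product diagram $A_1\leftarrow X\to A_2$ (top row), a bottom row $B_1\leftarrow Y\to B_2$, and vertical morphisms $A_1\to B_1$, $X\to Y$,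 $A_2\to B_2$ all in $\mathcal{M}$, the bottom row is a product diagram if and only if both squares are $\mathcal{M}$-pushouts. $X$ is projection-coextensive if it is $\mathcal{M}$-coextensive with $\mathcal{M}$ the class of all product projections. *)

(* Defs.v *)
From Stdlib Require Import List FinFun RelationClasses.

Set Implicit Arguments.
Unset Strict Implicit.
Unset Printing Implicit Defensive.

Record Category := {
  obj :> Type;
  hom : obj -> obj -> Type;
  idm : forall X, hom X X;
  comp : forall X Y Z, hom Y Z -> hom X Y -> hom X Z;
  comp_idl : forall X Y (f : hom X Y), comp (idm Y) f = f;
  comp_idr : forall X Y (f : hom X Y), comp f (idm X) = f;
  comp_assoc : forall W X Y Z (h : hom Y Z) (g : hom X Y) (f : hom W X),
    comp h (comp g f) = comp (comp h g) f
}.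

Arguments hom {c} X Y.
Arguments idm {c} X.
Arguments comp {c X Y Z} g f.

Declare Scope cat_scope.
Delimit Scope cat_scope with cat.
Notation "g ∘ f" := (comp g f) (at level 40, left associativity) : cat_scope.
Local Open Scope cat_scope.

Record Functor (J C : Category) := {
  fobj :> J -> C;
  fmap : forall i j, hom i j -> hom (fobj i) (fobj j);
  fmap_id : forall i, fmap (idm i) = idm (fobj i);
  fmap_comp : forall i j k (b : hom j k) (a : hom i j),
    fmap (b ∘ a) = fmap b ∘ fmap a
}.

Arguments fmap {J C} D {i j} a : rename.

Definition is_cone (J C : Category) (D : Functor J C) (L : C)
    (l : forall j, hom L (D j)) : Prop :=
  forall i j (a : hom i j), fmap D a ∘ l i = l j.

Definition is_limit (J C : Category) (D : Functor J C) (L : C)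
    (l : forall j, hom L (D j)) : Prop :=
  is_cone l /\
  forall (S : C) (s : forall j, hom S (D j)), is_cone s ->
    exists! h : hom S L, forall j, l j ∘ h = s j.

Definition finite_category (J : Category) : Prop :=
  Finite J /\ forall i j : J, Finite (hom i j).

Definition has_finite_limits (C : Category) : Prop :=
  forall J : Category, finite_category J ->
  forall D : Functor J C,
  exists (L : C) (l : forall j, hom L (D j)), is_limit l.

Section Notions.

Variable C : Category.

Definition is_terminal (T : C) : Prop :=
  forall S : C, exists! h : hom S T, True.

Definition is_product (X A1 A2 : C) (p1 : hom X A1) (p2 : hom X A2) : Prop :=
  forall (S : C) (s1 : hom S A1) (s2 : hom S A2),
    exists! h : hom S X, p1 ∘ h = s1 /\ p2 ∘ h = s2.

Definition is_product3 (P X Y Z : C)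
    (p1 : hom P X) (p2 : hom P Y) (p3 : hom P Z) : Prop :=
  forall (S : C) (x : hom S X) (y : hom S Y) (z : hom S Z),
    exists! h : hom S P, p1 ∘ h = x /\ p2 ∘ h = y /\ p3 ∘ h = z.

Definition monic (X Y : C) (m : hom X Y) : Prop :=
  forall (S : C) (a b : hom S X), m ∘ a = m ∘ b -> a = b.

Definition is_pullback (P X Y Z : C) (f : hom X Z) (g : hom Y Z)
    (p1 : hom P X) (p2 : hom P Y) : Prop :=
  f ∘ p1 = g ∘ p2 /\
  forall (S : C) (s1 : hom S X) (s2 : hom S Y), f ∘ s1 = g ∘ s2 ->
    exists! h : hom S P, p1 ∘ h = s1 /\ p2 ∘ h = s2.

Definition is_pushout (X Y Z P : C) (f : hom X Y) (g : hom X Z)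
    (u : hom Y P) (v : hom Z P) : Prop :=
  u ∘ f = v ∘ g /\
  forall (S : C) (s : hom Y S) (t : hom Z S), s ∘ f = t ∘ g ->
    exists! h : hom P S, h ∘ u = s /\ h ∘ v = t.

Definition is_coequalizer (R X Q : C) (a b : hom R X) (q : hom X Q) : Prop :=
  q ∘ a = q ∘ b /\
  forall (S : C) (s : hom X S), s ∘ a = s ∘ b ->
    exists! h : hom Q S, h ∘ q = s.

Definition is_kernel_pair (K X Y : C) (f : hom X Y) (k1 k2 : hom K X) : Prop :=
  is_pullback f f k1 k2.

Definition regular_epi (X Y : C) (f : hom X Y) : Prop :=
  exists (R : C) (a b : hom R X), is_coequalizer a b f.

Definition regular : Prop :=
  has_finite_limits C /\
  (forall (K X Y : C) (f : hom X Y) (k1 k2 : hom K X),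
     is_kernel_pair f k1 k2 ->
     exists (Q : C) (q : hom X Q), is_coequalizer k1 k2 q) /\
  (forall (P X Y Z : C) (f : hom X Z) (g : hom Y Z)
          (p1 : hom P X) (p2 : hom P Y),
     is_pullback f g p1 p2 -> regular_epi f -> regular_epi p2).

Definition global_support (X : C) : Prop :=
  exists (T : C) (t : hom X T), is_terminal T /\ regular_epi t.

(* A subobject of X × X, presented by its two jointly monic components. *)
Record BinRel (X : C) := {
  rel_obj :> C;
  leg1 : hom rel_obj X;
  leg2 : hom rel_obj X;
  legs_monic : forall (S : C) (a b : hom S rel_obj),
    leg1 ∘ a = leg1 ∘ b -> leg2 ∘ a = leg2 ∘ b -> a = b
}.


Arguments leg1 {X} R : rename.
Arguments leg2 {X} R : rename.

(* (a, b) : S -> X × X factors through R. *)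
Definition related (X : C) (R : BinRel X) (S : C) (a b : hom S X) : Prop :=
  exists h : hom S R, leg1 R ∘ h = a /\ leg2 R ∘ h = b.

Definition is_equivalence (X : C) (R : BinRel X) : Prop :=
  forall S : C, Equivalence (@related X R S).

(* The order of subobjects of X × X; equality of subobjects is the induced
   equivalence, so meets are specified rather than chosen. *)
Definition rel_le (X : C) (R R' : BinRel X) : Prop :=
  related R' (leg1 R) (leg2 R).

Definition is_intersection (X : C) (I E1 E2 : BinRel X) : Prop :=
  rel_le I E1 /\ rel_le I E2 /\
  forall R : BinRel X, rel_le R E1 -> rel_le R E2 -> rel_le R I.

Definition is_effective_closure (X : C) (F E : BinRel X) : Prop :=
  exists (Q : C) (q : hom X Q),
    is_coequalizer (leg1 E) (leg2 E) q /\ is_kernel_pair q (leg1 F) (leg2 F).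

Definition pre_exact : Prop :=
  regular /\
  (forall (X : C) (E : BinRel X), is_equivalence E ->
     exists (Q : C) (q : hom X Q), is_coequalizer (leg1 E) (leg2 E) q) /\
  (forall (X : C) (E1 E2 E F1 F2 F : BinRel X),
     is_equivalence E1 -> is_equivalence E2 -> is_intersection E E1 E2 ->
     is_effective_closure F1 E1 -> is_effective_closure F2 E2 ->
     is_effective_closure F E ->
     is_intersection F F1 F2).

(* (x, y, z) : S -> P factors through r, where P is a product of X, Y, Z with
   projections p1, p2, p3. *)
Definition factors3 (R P X Y Z : C) (r : hom R P)
    (p1 : hom P X) (p2 : hom P Y) (p3 : hom P Z)
    (S : C) (x : hom S X) (y : hom S Y) (z : hom S Z) : Prop :=
  exists h : hom S R,
    p1 ∘ (r ∘ h) = x /\ p2 ∘ (r ∘ h) = y /\ p3 ∘ (r ∘ h) = z.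

Definition majority : Prop :=
  forall (R P X Y Z : C) (p1 : hom P X) (p2 : hom P Y) (p3 : hom P Z)
         (r : hom R P),
  is_product3 p1 p2 p3 -> monic r ->
  forall (S : C) (x x' : hom S X) (y y' : hom S Y) (z z' : hom S Z),
  factors3 r p1 p2 p3 x y z' ->
  factors3 r p1 p2 p3 x y' z ->
  factors3 r p1 p2 p3 x' y z ->
  factors3 r p1 p2 p3 x y z.

Definition product_projection (X A : C) (p : hom X A) : Prop :=
  exists (A' : C) (p' : hom X A'), is_product p p'.

Definition is_M_pushout (M : forall X Y : C, hom X Y -> Prop) (X Y Z P : C)
    (f : hom X Y) (g : hom X Z) (u : hom Y P) (v : hom Z P) : Prop :=
  is_pushout f g u v /\ M Y P u /\ M Z P v.

Definition coextensive (M : forall X Y : C, hom X Y -> Prop) (X : C) : Prop :=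
  (forall (Y A : C) (f : hom X Y) (p : hom X A),
     M X Y f -> product_projection p ->
     exists (P : C) (u : hom Y P) (v : hom A P), is_M_pushout M f p u v) /\
  (forall (A1 A2 Y B1 B2 : C)
          (p1 : hom X A1) (p2 : hom X A2) (q1 : hom Y B1) (q2 : hom Y B2)
          (a1 : hom A1 B1) (f : hom X Y) (a2 : hom A2 B2),
     is_product p1 p2 ->
     M A1 B1 a1 -> M X Y f -> M A2 B2 a2 ->
     q1 ∘ f = a1 ∘ p1 -> q2 ∘ f = a2 ∘ p2 ->
     (is_product q1 q2 <->
      is_M_pushout M f p1 q1 a1 /\ is_M_pushout M f p2 q2 a2)).

Definition projection_coextensive (X : C) : Prop :=
  coextensive product_projection X.

End Notions.

(* Main.v *)
(** Write [X = Y × Y'] with projections [f], [f'] and let [p : X -> A] be another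
    product projection.  By the majority property, relating [(y1, y1')] to
    [(y2, y2')] when [p (y1, y1') = p (y2, y1')] defines an equivalence relation
    [E] on [X]; it contains the kernel pairs of [f] and [p] and is the join of
    the two, so its coequalizer is the pushout of [f] and [p].  If [A'] is a
    complement of [A], the analogous relation for [X -> A'] meets [E] in the
    kernel pair of [f].  Pre-exactness carries this over to effective closures,
    so [Y] embeds in the product of the two pushouts, and it covers that product
    because [X = A × A'] does.  Global support makes all product projections of
    [X] regular epimorphisms. *)

Require Import Defs.
From Stdlib Require Import List.

Set Implicit Arguments.
Unset Strict Implicit.
Unset Printing Implicit Defensive.
Local Open Scope cat_scope.

(** * Limits of small shapes *)

Definition empty_category : Category.
Proof.
  refine (@Build_Category Empty_set (fun _ _ => unit) (fun _ => tt)
    (fun _ _ _ _ _ => tt) _ _ _); intros [].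
Defined.

Definition empty_functor (C : Category) : Functor empty_category C.
Proof.
  refine (@Build_Functor empty_category C
    (fun i : Empty_set => match i with end)
    (fun i : Empty_set => match i with end) _ _); intros [].
Defined.

(* [None] is the apex of the cospan [Some true -> None <- Some false]. *)
Definition cospan_hom (i j : option bool) : Type :=
  match i, j with
  | _, None | Some true, Some true | Some false, Some false => unit
  | _, _ => Empty_set
  end.

Definition cospan_category : Category.
Proof.
  refine (@Build_Category (option bool) cospan_hom
    (fun i => match i with Some true | Some false | None => tt end)
    (fun i j k => match i, j, k with
       | Some true, Some true, Some true
       | Some false, Some false, Some false => fun _ _ => tt
       | Some true, _, None | Some false, _, None | None, _, None =>
           fun _ _ => tt
       | _, Some true, Some false | _, Some false, Some true
       | _, None, Some _ => fun b _ => match b with end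
       | Some true, Some false, _ | Some false, Some true, _
       | None, Some _, _ => fun _ a => match a with end
       end) _ _ _).
  - now intros [[]|] [[]|] [].
  - now intros [[]|] [[]|] [].
  - now intros [[]|] [[]|] [[]|] [[]|] [] [] [].
Defined.

Definition cospan_functor (C : Category) (X Y Z : C)
    (f : hom X Z) (g : hom Y Z) : Functor cospan_category C.
Proof.
  refine (@Build_Functor cospan_category C
    (fun i : option bool =>
       match i with Some true => X | Some false => Y | None => Z end)
    (fun i j : option bool => match i, j with
       | Some true, Some true => fun _ => idm X
       | Some false, Some false => fun _ => idm Y
       | None, None => fun _ => idm Z
       | Some true, None => fun _ => f
       | Some false, None => fun _ => g
       | _, _ => fun a => match a with end
       end) _ _).
  - now intros [[]|].
  - intros [[]|] [[]|] [[]|] [] []; cbn;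
      now rewrite ?comp_idl, ?comp_idr.
Defined.

Section FiniteLimits.

Variable C : Category.
Hypothesis limC : has_finite_limits C.

Lemma terminal_exists : exists T : C, is_terminal T.
Proof.
  assert (fin : finite_category empty_category).
  { split; [exists nil; intros [] | intros []]. }
  destruct (limC fin (empty_functor C)) as (T & l & _ & lu).
  exists T; intros S.
  destruct (lu S (fun j : Empty_set => match j with end)) as (h & _ & hu).
  { intros []. }
  exists h; split; [exact I|].
  intros h' _; apply hu; intros [].
Qed.

Lemma pullback_exists (X Y Z : C) (f : hom X Z) (g : hom Y Z) :
  exists (P : C) (p1 : hom P X) (p2 : hom P Y), is_pullback f g p1 p2.
Proof.
  assert (fin : finite_category cospan_category).
  { split.
    - exists (Some true :: Some false :: None :: nil).
      intros [[]|]; cbn; tauto.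
    - intros [[]|] [[]|]; (exists nil; intros []; fail) ||
        (exists (tt :: nil); intros []; now left). }
  destruct (limC fin (cospan_functor f g)) as (P & l & lc & lu).
  pose proof (lc (Some true) None tt) as e1; cbn in e1.
  pose proof (lc (Some false) None tt) as e2; cbn in e2.
  exists P, (l (Some true)), (l (Some false)); split.
  { exact (eq_trans e1 (eq_sym e2)). }
  intros S s1 s2 e.
  destruct (lu S (fun j : option bool =>
      match j as j return hom S (cospan_functor f g j) with
      | Some true => s1 | Some false => s2 | None => f ∘ s1 end))
    as (h & hh & hu).
  { intros [[]|] [[]|] []; cbn; rewrite ?comp_idl; auto. }
  exists h; split.
  { split; [exact (hh (Some true)) | exact (hh (Some false))]. }
  intros h' [h1 h2]; apply hu; intros [[]|]; auto.
  rewrite <- e1. rewrite <- h1. symmetry; apply comp_assoc.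
Qed.

Lemma product_exists (X Y : C) :
  exists (P : C) (p1 : hom P X) (p2 : hom P Y), is_product p1 p2.
Proof.
  destruct terminal_exists as (T & hT).
  destruct (hT X) as (tX & _), (hT Y) as (tY & _).
  destruct (pullback_exists tX tY) as (P & p1 & p2 & _ & pu).
  exists P, p1, p2; intros S s1 s2; apply pu.
  destruct (hT S) as (t & _ & tu).
  rewrite <- (tu (tX ∘ s1) I); apply tu; exact I.
Qed.

(** Pull back [(g, h) : X -> Z × Z] along the diagonal of [Z]. The leg [n] to [Z] equals [g ∘ m], so
    [m] alone is already monic. *)
Lemma equalizer_exists (X Z : C) (g h : hom X Z) :
  exists (E : C) (m : hom E X), monic m /\ g ∘ m = h ∘ m /\
    forall (S : C) (s : hom S X), g ∘ s = h ∘ s -> exists t, m ∘ t = s.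
Proof.
  destruct (product_exists Z Z) as (ZZ & z1 & z2 & hZ).
  destruct (hZ X g h) as (gh & [gh1 gh2] & _).
  destruct (hZ Z (idm Z) (idm Z)) as (d & [d1 d2] & _).
  destruct (pullback_exists gh d) as (E & m & n & e & mu).
  assert (gn : g ∘ m = n).
  { now rewrite <- gh1, <- comp_assoc, e, comp_assoc, d1, comp_idl. }
  assert (hn : h ∘ m = n).
  { now rewrite <- gh2, <- comp_assoc, e, comp_assoc, d2, comp_idl. }
  exists E, m; split; [|split].
  - intros S a b ab.
    destruct (mu S (m ∘ a) (n ∘ a)) as (c & _ & cu).
    { now rewrite !comp_assoc, e. }
    rewrite <- (cu a); [|now split].
    apply cu; split; [easy|].
    now rewrite <- gn, <- !comp_assoc, ab.
  - congruence.
  - intros S s gs.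
    destruct (mu S s (g ∘ s)) as (t & [t1 _] & _); [|now exists t].
    destruct (hZ S (g ∘ s) (g ∘ s)) as (w & _ & wu).
    rewrite <- (wu (gh ∘ s)), <- (wu (d ∘ (g ∘ s))); auto.
    + now rewrite !comp_assoc, d1, d2, comp_idl.
    + rewrite !comp_assoc, gh1, gh2; now split.
Qed.

Lemma kernel_rel_exists (X Y : C) (f : hom X Y) :
  exists K : BinRel X, is_kernel_pair f (leg1 K) (leg2 K).
Proof.
  destruct (pullback_exists f f) as (K & k1 & k2 & e & ku).
  assert (mon : forall (S : C) (a b : hom S K),
      k1 ∘ a = k1 ∘ b -> k2 ∘ a = k2 ∘ b -> a = b).
  { intros S a b h1 h2.
    destruct (ku S (k1 ∘ a) (k2 ∘ a)) as (c & _ & cu).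
    { now rewrite !comp_assoc, e. }
    rewrite <- (cu a), <- (cu b); auto. }
  exists (Build_BinRel mon); split; assumption.
Qed.

End FiniteLimits.

(** * Products, kernel pairs and regular epimorphisms *)

Section Generalities.

Variable C : Category.

Definition epic (X Y : C) (e : hom X Y) : Prop :=
  forall (S : C) (a b : hom Y S), a ∘ e = b ∘ e -> a = b.

Lemma product_swap (X A1 A2 : C) (p1 : hom X A1) (p2 : hom X A2) :
  is_product p1 p2 -> is_product p2 p1.
Proof.
  intros hp S s1 s2; destruct (hp S s2 s1) as (h & [h1 h2] & hu).
  exists h; split; [now split|]; intros h' []; apply hu; now split.
Qed.

Lemma product_ext (X A1 A2 : C) (p1 : hom X A1) (p2 : hom X A2) :
  is_product p1 p2 ->
  forall (S : C) (a b : hom S X), p1 ∘ a = p1 ∘ b -> p2 ∘ a = p2 ∘ b -> a = b.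
Proof.
  intros hp S a b e1 e2.
  destruct (hp S (p1 ∘ a) (p2 ∘ a)) as (h & _ & hu).
  rewrite <- (hu a), <- (hu b); auto.
Qed.

Lemma pushout_swap (X Y Z P : C) (f : hom X Y) (g : hom X Z)
    (u : hom Y P) (v : hom Z P) :
  is_pushout f g u v -> is_pushout g f v u.
Proof.
  intros [e hu]; split; [easy|]; intros S s t st.
  destruct (hu S t s) as (h & [h1 h2] & hun); [easy|].
  exists h; split; [now split|]; intros h' []; apply hun; now split.
Qed.

Lemma kernel_pair_related (X Y : C) (f : hom X Y) (K : BinRel X) :
  is_kernel_pair f (leg1 K) (leg2 K) ->
  forall (S : C) (a b : hom S X), related K a b <-> f ∘ a = f ∘ b.
Proof.
  intros [e ku] S a b; split.
  - intros (h & <- & <-); now rewrite !comp_assoc, e.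
  - intros ab; destruct (ku S a b ab) as (h & hh & _); now exists h.
Qed.

Lemma coequalizer_epic (R X Q : C) (a b : hom R X) (q : hom X Q) :
  is_coequalizer a b q -> epic q.
Proof.
  intros [e qu] S s t st.
  destruct (qu S (s ∘ q)) as (h & _ & hu).
  { now rewrite <- !comp_assoc, e. }
  rewrite <- (hu s), <- (hu t); auto.
Qed.

Lemma regular_epi_epic (X Y : C) (e : hom X Y) : regular_epi e -> epic e.
Proof. intros (R & a & b & he); exact (coequalizer_epic he). Qed.

Lemma regular_epi_factor (X Y Z : C) (e : hom X Y) (g : hom X Z) :
  regular_epi e ->
  (forall (S : C) (a b : hom S X), e ∘ a = e ∘ b -> g ∘ a = g ∘ b) ->
  exists h : hom Y Z, h ∘ e = g.
Proof.
  intros (R & a & b & eab & eu) hg.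
  destruct (eu Z g (hg R a b eab)) as (h & hh & _); now exists h.
Qed.

Lemma regular_epi_kernel_coequalizer (X Y K : C) (f : hom X Y)
    (k1 k2 : hom K X) :
  regular_epi f -> is_kernel_pair f k1 k2 -> is_coequalizer k1 k2 f.
Proof.
  intros hf [e ku]; split; [exact e|]; intros S s sk.
  destruct (@regular_epi_factor X Y S f s hf) as (h & hh).
  { intros T a b ab; destruct (ku T a b ab) as (c & [<- <-] & _).
    now rewrite !comp_assoc, sk. }
  exists h; split; [exact hh|]; intros h' hh'.
  apply (regular_epi_epic hf); congruence.
Qed.

(** If [g ∘ r] is a coequalizer of [a], [b], then [g] is one of [r ∘ a], [r ∘ b], since morphisms
    out of [Y] can be compared after the epic [r]. *)
Lemma regular_epi_cancel (X Y Z : C) (r : hom X Y) (g : hom Y Z) :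
  epic r -> regular_epi (g ∘ r) -> regular_epi g.
Proof.
  intros hr (R & a & b & e & gu).
  exists R, (r ∘ a), (r ∘ b); split.
  { now rewrite !comp_assoc. }
  intros S s sr.
  destruct (gu S (s ∘ r)) as (h & hh & hu).
  { now rewrite <- !comp_assoc. }
  rewrite comp_assoc in hh.
  exists h; split; [now apply hr|].
  intros h' hh'; apply hu; now rewrite comp_assoc, hh'.
Qed.

(** Joint monicity of [u], [u'] makes solutions unique, so a solution [y] found on the cover [e]
    identifies whatever [e] identifies and descends along it. *)
Lemma regular_epi_descent (Y P P' S S' : C) (u : hom Y P) (u' : hom Y P')
    (s : hom S P) (s' : hom S P') (e : hom S' S) (y : hom S' Y) :
  (forall (T : C) (a b : hom T Y), u ∘ a = u ∘ b -> u' ∘ a = u' ∘ b -> a = b) ->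
  regular_epi e -> u ∘ y = s ∘ e -> u' ∘ y = s' ∘ e ->
  exists h : hom S Y, u ∘ h = s /\ u' ∘ h = s'.
Proof.
  intros mon he hy hy'.
  destruct (@regular_epi_factor _ _ _ e y he) as (h & hh).
  { intros T a b ab; apply mon; rewrite !comp_assoc, ?hy, ?hy';
      now rewrite <- !comp_assoc, ab. }
  exists h; split; apply (regular_epi_epic he);
    now rewrite <- comp_assoc, hh.
Qed.

(** This replaces the choice of preimages under [f]: the cover of [S] is the pullback of [f] along
    [y]. *)
Lemma regular_epi_lift (X Y S : C) (f : hom X Y) (y : hom S Y) :
  regular C -> regular_epi f ->
  exists (S' : C) (e : hom S' S) (x : hom S' X), regular_epi e /\ f ∘ x = y ∘ e.
Proof.
  intros (limC & _ & stab) hf.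
  destruct (pullback_exists limC f y) as (S' & x & e & pb).
  exists S', e, x; split; [exact (stab _ _ _ _ _ _ _ _ pb hf) | apply pb].
Qed.

(* [p1] absorbs the surplus variable of [X × A1 -> A1], which is a pullback of
   [X -> 1]. *)
Lemma projection_regular_epi (X A1 A2 : C) (p1 : hom X A1) (p2 : hom X A2) :
  regular C -> global_support X -> is_product p1 p2 -> regular_epi p1.
Proof.
  intros (limC & _ & stab) (T & t & hT & ht) hp.
  assert (tu : forall (S : C) (a b : hom S T), a = b).
  { intros S a b; destruct (hT S) as (c & _ & cu).
    rewrite <- (cu a I); now apply cu. }
  destruct (hT A1) as (t1 & _).
  destruct (pullback_exists limC t t1) as (Z & z1 & z2 & pb).
  pose proof (stab _ _ _ _ _ _ _ _ pb ht) as hz2.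
  (* In elements, [r] sends [(x, a)] to the point of [X] with coordinates [a] and [p2 x]. It is
     split by [x ↦ (x, p1 x)], hence epic, and [p1 ∘ r] is the regular epimorphism [z2]. *)
  destruct (hp Z z2 (p2 ∘ z1)) as (r & [r1 r2] & _).
  apply (@regular_epi_cancel Z X A1 r p1); [|now rewrite r1].
  destruct pb as [_ zu].
  destruct (zu X (idm X) p1 (tu _ _ _)) as (s & [s1 s2] & _).
  assert (rs : r ∘ s = idm X).
  { apply (product_ext hp).
    - now rewrite comp_assoc, r1, s2, comp_idr.
    - now rewrite comp_assoc, r2, <- comp_assoc, s1. }
  intros S a b ab.
  now rewrite <- (comp_idr a), <- (comp_idr b), <- rs, !comp_assoc, ab.
Qed.

Lemma global_support_epic (X Y : C) (e : hom X Y) :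
  epic e -> global_support X -> global_support Y.
Proof.
  intros he (T & t & hT & ht).
  destruct (hT Y) as (t' & _).
  exists T, t'; split; [exact hT|].
  apply (regular_epi_cancel he).
  destruct (hT X) as (c & _ & cu).
  now rewrite <- (cu (t' ∘ e) I), (cu t I).
Qed.

End Generalities.

(** * The relation of pairs linked by a quotient of a product *)

Section Linked.

Variables (C : Category) (X Y Y' : C) (f : hom X Y) (f' : hom X Y').
Hypothesis prodX : is_product f f'.

(* Writing elements of [X] as pairs, [(y1, y1')] and [(y2, y2')] are linked by
   [g] when [g (y2, y1') = g (y1, y1')]. *)
Definition linked (A : C) (g : hom X A) (S : C) (a b : hom S X) : Prop :=
  forall c : hom S X, f ∘ c = f ∘ b -> f' ∘ c = f' ∘ a -> g ∘ c = g ∘ a.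

Lemma linked_rel_exists (A : C) (g : hom X A) :
  has_finite_limits C ->
  exists E : BinRel X,
    forall (S : C) (a b : hom S X), related E a b <-> linked g a b.
Proof.
  intros limC.
  destruct (product_exists limC X X) as (XX & x1 & x2 & hXX).
  (* [c] is the generic mixed point, with [Y]-coordinate from the second argument and
     [Y']-coordinate from the first. The relation is the part of [X × X] where [g] agrees on [c] and
     on the first argument. *)
  destruct (prodX (f ∘ x2) (f' ∘ x1)) as (c & [c1 c2] & _).
  destruct (equalizer_exists limC (g ∘ c) (g ∘ x1)) as (E & m & mm & me & mu).
  assert (mon : forall (S : C) (a b : hom S E),
      x1 ∘ m ∘ a = x1 ∘ m ∘ b -> x2 ∘ m ∘ a = x2 ∘ m ∘ b -> a = b).
  { intros S a b e1 e2; apply mm; apply (product_ext hXX);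
      now rewrite !comp_assoc. }
  exists (Build_BinRel mon); intros S a b; split.
  - intros (h & <- & <-) d; cbn; intros d1 d2.
    assert (cd : d = c ∘ m ∘ h).
    { apply (product_ext prodX); rewrite ?d1, ?d2, !comp_assoc;
        now rewrite ?c1, ?c2. }
    now rewrite cd, !comp_assoc, me.
  - intros lab.
    destruct (hXX S a b) as (ab & [ab1 ab2] & _).
    destruct (mu S ab) as (h & hh).
    { rewrite <- (comp_assoc g x1), ab1, <- comp_assoc.
      apply lab; rewrite comp_assoc, ?c1, ?c2, <- comp_assoc; congruence. }
    exists h; cbn; rewrite <- !comp_assoc, hh; now split.
Qed.

Lemma kernel_linked (A : C) (g : hom X A) (S : C) (a b : hom S X) :
  f ∘ a = f ∘ b -> linked g a b.
Proof.
  intros ab c c1 c2; f_equal; apply (product_ext prodX); congruence.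
Qed.

Hypothesis limC : has_finite_limits C.
Hypothesis majC : majority C.

(* In elements, [g (y1, s) = g (y2, t)] implies [g (y1, z) = g (y2, z)]: apply
   the majority property to [(y1, y2, (s, t))], [(y1, y1, (z, z))] and
   [(y2, y2, (z, z))], which lie in the kernel relation of [g], viewed as a
   subobject of [Y × Y × (Y' × Y')]. *)
Lemma majority_cancel (A : C) (g : hom X A) (S : C) (a b c d : hom S X) :
  g ∘ a = g ∘ b -> f ∘ c = f ∘ a -> f ∘ d = f ∘ b -> f' ∘ c = f' ∘ d ->
  g ∘ c = g ∘ d.
Proof.
  intros gab ca db cd.
  destruct (product_exists limC X X) as (XX & x1 & x2 & hXX).
  destruct (product_exists limC Y' Y') as (W & w1 & w2 & hW).
  destruct (hW XX (f' ∘ x1) (f' ∘ x2)) as (w & [hw1 hw2] & _).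
  destruct (kernel_rel_exists limC g) as (K & kpK).
  pose proof (kernel_pair_related kpK) as relK.
  destruct (hXX K (leg1 K) (leg2 K)) as (r & [r1 r2] & _).
  assert (mr : monic r).
  { intros T s t st; apply legs_monic; rewrite <- ?r1, <- ?r2;
      now rewrite <- !comp_assoc, st. }
  assert (hXX3 : is_product3 (f ∘ x1) (f ∘ x2) w).
  { intros T y1 y2 z.
    destruct (prodX y1 (w1 ∘ z)) as (s & [s1 s2] & _).
    destruct (prodX y2 (w2 ∘ z)) as (t & [t1 t2] & _).
    destruct (hXX T s t) as (h & [h1 h2] & _).
    exists h; split.
    - rewrite <- !comp_assoc, h1, h2; repeat split; auto.
      apply (product_ext hW); rewrite comp_assoc, ?hw1, ?hw2, <- comp_assoc;
        congruence.
    - intros h' (e1 & e2 & e3).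
      rewrite <- comp_assoc in e1, e2.
      apply (product_ext hXX); apply (product_ext prodX);
        rewrite ?h1, ?h2; try congruence;
        rewrite comp_assoc, <- ?hw1, <- ?hw2, <- comp_assoc; congruence. }
  assert (fac : forall (s t : hom S X) (z : hom S W), g ∘ s = g ∘ t ->
      w1 ∘ z = f' ∘ s -> w2 ∘ z = f' ∘ t ->
      factors3 r (f ∘ x1) (f ∘ x2) w (f ∘ s) (f ∘ t) z).
  { intros s t z st z1 z2.
    destruct (proj2 (relK S s t) st) as (h & h1 & h2).
    assert (e1 : x1 ∘ (r ∘ h) = s) by now rewrite comp_assoc, r1.
    assert (e2 : x2 ∘ (r ∘ h) = t) by now rewrite comp_assoc, r2.
    exists h; rewrite <- !(comp_assoc f), e1, e2; repeat split.
    apply (product_ext hW); rewrite comp_assoc, ?hw1, ?hw2, <- comp_assoc;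
      congruence. }
  destruct (hW S (f' ∘ a) (f' ∘ b)) as (z' & [z'1 z'2] & _).
  destruct (hW S (f' ∘ c) (f' ∘ d)) as (z & [z1 z2] & _).
  destruct (@majC K XX Y Y W (f ∘ x1) (f ∘ x2) w r hXX3 mr S
      (f ∘ c) (f ∘ d) (f ∘ d) (f ∘ c) z z') as (h & e1 & e2 & e3).
  - rewrite ca, db; now apply fac.
  - apply fac; congruence.
  - apply fac; congruence.
  - assert (hc : x1 ∘ (r ∘ h) = c).
    { apply (product_ext prodX); [now rewrite comp_assoc|].
      now rewrite comp_assoc, <- hw1, <- comp_assoc, e3. }
    assert (hd : x2 ∘ (r ∘ h) = d).
    { apply (product_ext prodX); [now rewrite comp_assoc|].
      now rewrite comp_assoc, <- hw2, <- comp_assoc, e3. }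
    apply relK; exists h; now rewrite <- r1, <- r2, <- !comp_assoc.
Qed.

(** Cancellation with the [Y']-coordinate of [a] as common value. Together with [kernel_linked], it
    puts the kernel pairs of [g] and [f] inside the linked relation. *)
Lemma linked_of_eq (A : C) (g : hom X A) (S : C) (a b : hom S X) :
  g ∘ a = g ∘ b -> linked g a b.
Proof.
  intros gab c c1 c2; symmetry.
  now apply (majority_cancel gab).
Qed.

(** [majority_cancel] exchanges the shared second coordinate in [g (y2, y1') = g (y1, y1')].
    Symmetry puts [y2'] for [y1']; transitivity turns [g (y3, y2') = g (y2, y2')] into
    [g (y3, y1') = g (y2, y1')] and chains. *)
Lemma linked_equivalence (A : C) (g : hom X A) (E : BinRel X) :
  (forall (S : C) (a b : hom S X), related E a b <-> linked g a b) ->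
  is_equivalence E.
Proof.
  intros hE S; split.
  - intros a; apply hE; now apply kernel_linked.
  - intros a b ab%hE; apply hE; intros c c1 c2.
    destruct (prodX (f ∘ b) (f' ∘ a)) as (d & [d1 d2] & _).
    apply (majority_cancel (eq_sym (ab d d1 d2))); congruence.
  - intros a b c ab%hE bc%hE; apply hE; intros d d1 d2.
    destruct (prodX (f ∘ b) (f' ∘ a)) as (m & [m1 m2] & _).
    destruct (prodX (f ∘ c) (f' ∘ b)) as (n & [n1 n2] & _).
    rewrite <- (ab m m1 m2).
    apply (majority_cancel (bc n n1 n2)); congruence.
Qed.

(** A morphism on [X] coequalizes [E] exactly when it factors through both [f] and [p]: [E] contains
    both kernel pairs, and the members of a linked pair are joined by a mixed point [c] that agrees
    with one under [f] and with the other under [p]. *)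
Lemma pushout_iff_linked_coequalizer (A P : C) (p : hom X A)
    (u : hom Y P) (v : hom A P) (E : BinRel X) :
  regular_epi f -> regular_epi p ->
  (forall (S : C) (a b : hom S X), related E a b <-> linked p a b) ->
  u ∘ f = v ∘ p ->
  is_pushout f p u v <-> is_coequalizer (leg1 E) (leg2 E) (u ∘ f).
Proof.
  intros hf hp hE uv.
  assert (kill : forall (S : C) (s : hom Y S) (t : hom A S),
      s ∘ f = t ∘ p -> s ∘ f ∘ leg1 E = s ∘ f ∘ leg2 E).
  { intros S s t st.
    assert (lE : linked p (leg1 E) (leg2 E)).
    { apply hE; exists (idm E); now rewrite !comp_idr. }
    destruct (prodX (f ∘ leg2 E) (f' ∘ leg1 E)) as (c & [c1 c2] & _).
    rewrite <- (comp_assoc s f (leg2 E)), <- c1, comp_assoc, !st.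
    now rewrite <- !comp_assoc, (lE c c1 c2). }
  split.
  - intros [_ hu]; split; [exact (kill P u v uv)|]; intros S s sE.
    assert (sl : forall (T : C) (a b : hom T X), linked p a b -> s ∘ a = s ∘ b).
    { intros T a b (h & <- & <-)%hE; now rewrite !comp_assoc, sE. }
    destruct (@regular_epi_factor _ _ _ _ f s hf) as (s1 & hs1).
    { intros T a b ab; apply sl, kernel_linked, ab. }
    destruct (@regular_epi_factor _ _ _ _ p s hp) as (s2 & hs2).
    { intros T a b ab; apply sl, linked_of_eq, ab. }
    destruct (hu S s1 s2) as (h & [h1 h2] & hun); [congruence|].
    exists h; split; [now rewrite comp_assoc, h1|].
    intros h' hh'; apply hun; split.
    + apply (regular_epi_epic hf); now rewrite <- comp_assoc, hh'.
    + apply (regular_epi_epic hp); now rewrite <- comp_assoc, <- uv, hh'.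
  - intros [_ qu]; split; [exact uv|]; intros S s t st.
    destruct (qu S (s ∘ f) (kill S s t st)) as (h & hh & hun).
    exists h; split.
    + split.
      * apply (regular_epi_epic hf); now rewrite <- comp_assoc.
      * apply (regular_epi_epic hp); now rewrite <- comp_assoc, <- uv, hh.
    + intros h' [h1 h2]; apply hun; now rewrite comp_assoc, h1.
Qed.

End Linked.

(** * Pushouts of product projections and coextensivity *)

Section Coextensivity.

Variable C : Category.
Hypothesis preC : pre_exact C.
Hypothesis majC : majority C.

Lemma projection_pushout_exists (X Y Y' A A' : C) (f : hom X Y) (f' : hom X Y')
    (p : hom X A) (p' : hom X A') :
  global_support X -> is_product f f' -> is_product p p' ->
  exists (P : C) (u : hom Y P) (v : hom A P), is_pushout f p u v.
Proof.
  intros gX hf hp.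
  destruct preC as (regC & coeqC & _).
  pose proof (proj1 regC) as limC.
  pose proof (projection_regular_epi regC gX hf) as ef.
  pose proof (projection_regular_epi regC gX hp) as ep.
  destruct (linked_rel_exists hf p limC) as (E & hE).
  destruct (coeqC X E (linked_equivalence hf limC majC hE)) as (P & q & hq).
  assert (ql : forall (T : C) (a b : hom T X), linked f f' p a b -> q ∘ a = q ∘ b).
  { intros T a b (h & <- & <-)%hE; now rewrite !comp_assoc, (proj1 hq). }
  destruct (@regular_epi_factor _ _ _ _ f q ef) as (u & hu).
  { intros T a b ab; apply ql, (kernel_linked hf), ab. }
  destruct (@regular_epi_factor _ _ _ _ p q ep) as (v & hv).
  { intros T a b ab; apply ql, (linked_of_eq hf limC majC), ab. }
  exists P, u, v.
  apply (pushout_iff_linked_coequalizer hf limC majC ef ep hE); congruence.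
Qed.

(* The relations linked by [p] and by [p'] meet in the kernel pair of [f], so by
   pre-exactness the kernel pairs of their coequalizers do, too: [u] and [u']
   are jointly monic. *)
Lemma pushout_jointly_monic (X Y Y' A A' P P' : C)
    (f : hom X Y) (f' : hom X Y') (p : hom X A) (p' : hom X A')
    (u : hom Y P) (v : hom A P) (u' : hom Y P') (v' : hom A' P') :
  global_support X -> is_product f f' -> is_product p p' ->
  is_pushout f p u v -> is_pushout f p' u' v' ->
  forall (S : C) (a b : hom S Y), u ∘ a = u ∘ b -> u' ∘ a = u' ∘ b -> a = b.
Proof.
  intros gX hf hp po po'.
  destruct preC as (regC & _ & capC).
  pose proof (proj1 regC) as limC.
  pose proof (projection_regular_epi regC gX hf) as ef.
  pose proof (projection_regular_epi regC gX hp) as ep.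
  pose proof (projection_regular_epi regC gX (product_swap hp)) as ep'.
  destruct (linked_rel_exists hf p limC) as (E1 & hE1).
  destruct (linked_rel_exists hf p' limC) as (E2 & hE2).
  destruct (kernel_rel_exists limC f) as (F & kF).
  destruct (kernel_rel_exists limC (u ∘ f)) as (F1 & kF1).
  destruct (kernel_rel_exists limC (u' ∘ f)) as (F2 & kF2).
  assert (cap : is_intersection F E1 E2).
  { split; [|split].
    - apply hE1, (kernel_linked hf), kF.
    - apply hE2, (kernel_linked hf), kF.
    - intros R l1%hE1 l2%hE2; apply (kernel_pair_related kF).
      (* The mixed point [c] agrees with [leg1 R] under both [p] and [p'], hence equals it, while it
         agrees with [leg2 R] under [f]. *)
      destruct (hf R (f ∘ leg2 R) (f' ∘ leg1 R)) as (c & [c1 c2] & _).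
      rewrite <- c1; f_equal; symmetry; apply (product_ext hp); auto. }
  (* [F] occurs twice: as the kernel pair of the regular epimorphism [f] it is its own effective
     closure. *)
  destruct (capC X E1 E2 F F1 F2 F) as (_ & _ & capF); auto.
  { exact (linked_equivalence hf limC majC hE1). }
  { exact (linked_equivalence hf limC majC hE2). }
  { exists P, (u ∘ f); split; [|exact kF1].
    apply (pushout_iff_linked_coequalizer hf limC majC ef ep hE1 (proj1 po)), po. }
  { exists P', (u' ∘ f); split; [|exact kF2].
    apply (pushout_iff_linked_coequalizer hf limC majC ef ep' hE2 (proj1 po')), po'. }
  { exists Y, f; split; [exact (regular_epi_kernel_coequalizer ef kF) | exact kF]. }
  assert (monX : forall (S : C) (a b : hom S X),
      u ∘ f ∘ a = u ∘ f ∘ b -> u' ∘ f ∘ a = u' ∘ f ∘ b -> f ∘ a = f ∘ b).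
  { intros S a b ab ab'.
    (* [capF] tests only relations, so [(a, b)] is factored through a relation [R], the meet of [F1]
       and [F2] formed as an equalizer inside [F1]. *)
    destruct (equalizer_exists limC (u' ∘ f ∘ leg1 F1) (u' ∘ f ∘ leg2 F1))
      as (R & m & mm & me & mu).
    assert (mon : forall (T : C) (s t : hom T R),
        leg1 F1 ∘ m ∘ s = leg1 F1 ∘ m ∘ t ->
        leg2 F1 ∘ m ∘ s = leg2 F1 ∘ m ∘ t -> s = t).
    { intros T s t e1 e2; apply mm, legs_monic; now rewrite !comp_assoc. }
    assert (RF : rel_le (Build_BinRel mon) F).
    { apply capF.
      - exists m; now split.
      - apply (kernel_pair_related kF2); cbn; now rewrite !comp_assoc. }
    apply (kernel_pair_related kF) in RF; cbn in RF.
    destruct (proj2 (kernel_pair_related kF1 a b) ab) as (h & <- & <-).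
    destruct (mu S h) as (k & <-).
    { now rewrite <- !(comp_assoc (u' ∘ f)). }
    rewrite !comp_assoc in RF; now rewrite !comp_assoc, RF. }
  intros S a b ab ab'.
  (* Points of [Y] are lifted along [f] on a common cover, where [monX] applies. *)
  destruct (regular_epi_lift a regC ef) as (S1 & e1 & x1 & he1 & hx1).
  destruct (regular_epi_lift (b ∘ e1) regC ef) as (S2 & e2 & x2 & he2 & hx2).
  apply (regular_epi_epic he1), (regular_epi_epic he2).
  rewrite <- hx1, <- hx2, <- comp_assoc.
  apply monX; rewrite <- !(comp_assoc _ f), hx2, (comp_assoc f), hx1;
    rewrite !comp_assoc; now rewrite ?ab, ?ab'.
Qed.

(** Uniqueness is joint monicity. For existence, lift [s] and [s'] on covers to points of [A] and
    [A'], pair these to a point of [X], and descend its image under [f]. *)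
Lemma pushout_product (X Y Y' A A' P P' : C)
    (f : hom X Y) (f' : hom X Y') (p : hom X A) (p' : hom X A')
    (u : hom Y P) (v : hom A P) (u' : hom Y P') (v' : hom A' P') :
  global_support X -> is_product f f' -> is_product p p' ->
  is_pushout f p u v -> is_pushout f p' u' v' -> is_product u u'.
Proof.
  intros gX hf hp po po'.
  pose proof (pushout_jointly_monic gX hf hp po po') as mon.
  pose proof (proj1 preC) as regC; pose proof (proj1 regC) as limC.
  pose proof (projection_regular_epi regC gX hf) as ef.
  pose proof (projection_regular_epi regC gX hp) as ep.
  pose proof (projection_regular_epi regC gX (product_swap hp)) as ep'.
  (* [t ∘ g = s ∘ f] is a coequalizer of the linked relation, and the epic [g] can be cancelled. *)
  assert (hv : forall (B Q : C) (g : hom X B) (s : hom Y Q) (t : hom B Q),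
      regular_epi g -> is_pushout f g s t -> regular_epi t).
  { intros B Q g s t eg pg.
    destruct (linked_rel_exists hf g limC) as (E & hE).
    apply (regular_epi_cancel (regular_epi_epic eg)).
    rewrite <- (proj1 pg); exists E, (leg1 E), (leg2 E).
    apply (pushout_iff_linked_coequalizer hf limC majC ef eg hE (proj1 pg)), pg. }
  intros S s s'.
  destruct (regular_epi_lift s regC (hv _ _ _ _ _ ep po))
    as (S1 & e1 & x1 & he1 & hx1).
  destruct (regular_epi_lift (s' ∘ e1) regC (hv _ _ _ _ _ ep' po'))
    as (S2 & e2 & x2 & he2 & hx2).
  destruct (hp S2 (x1 ∘ e2) x2) as (x & [px1 px2] & _).
  destruct (@regular_epi_descent _ _ _ _ _ _ u u' (s ∘ e1) (s' ∘ e1) e2 (f ∘ x)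
    mon he2) as (y & y1 & y2).
  { now rewrite comp_assoc, (proj1 po), <- comp_assoc, px1, comp_assoc, hx1. }
  { now rewrite comp_assoc, (proj1 po'), <- comp_assoc, px2. }
  destruct (@regular_epi_descent _ _ _ _ _ _ u u' s s' e1 y mon he1 y1 y2)
    as (h & h1 & h2).
  exists h; split; [now split|].
  intros h' [h'1 h'2]; apply mon; congruence.
Qed.

(* A morphism on [Y = B1 × B2] that factors through [A1] after precomposition
   with [f = a1 × a2] does not depend on [B2], because [A2 -> B2] is a regular
   epimorphism. *)
Lemma product_pushout (X Y A1 A2 B1 B2 : C)
    (p1 : hom X A1) (p2 : hom X A2) (q1 : hom Y B1) (q2 : hom Y B2)
    (a1 : hom A1 B1) (f : hom X Y) (a2 : hom A2 B2) :
  regular C -> is_product p1 p2 -> is_product q1 q2 ->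
  epic p1 -> regular_epi q1 -> regular_epi a1 -> regular_epi a2 ->
  q1 ∘ f = a1 ∘ p1 -> q2 ∘ f = a2 ∘ p2 -> is_pushout f p1 q1 a1.
Proof.
  intros regC hp hq ep eq1 ea1 ea2 sq1 sq2; split; [exact sq1|].
  intros S s t st.
  destruct (@regular_epi_factor _ _ _ _ q1 s eq1) as (h & hh).
  { intros T k l kl.
    (* On a cover, [x] lies over the common first coordinate of [k] and [l], and [y], [z] over their
       second coordinates. Then [m = (x, y)] and [n = (x, z)] lie over [k] and [l] and agree under
       [p1], so [s ∘ f = t ∘ p1] identifies them. *)
    destruct (regular_epi_lift (q1 ∘ k) regC ea1) as (T1 & e1 & x & he1 & hx).
    destruct (regular_epi_lift (q2 ∘ k ∘ e1) regC ea2) as (T2 & e2 & y & he2 & hy).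
    destruct (regular_epi_lift (q2 ∘ l ∘ e1 ∘ e2) regC ea2)
      as (T3 & e3 & z & he3 & hz).
    destruct (hp T3 (x ∘ e2 ∘ e3) (y ∘ e3)) as (m & [m1 m2] & _).
    destruct (hp T3 (x ∘ e2 ∘ e3) z) as (n & [n1 n2] & _).
    assert (fm : f ∘ m = k ∘ e1 ∘ e2 ∘ e3).
    { apply (product_ext hq); rewrite !comp_assoc.
      - now rewrite sq1, <- comp_assoc, m1, !comp_assoc, hx.
      - now rewrite sq2, <- comp_assoc, m2, !comp_assoc, hy. }
    assert (fn : f ∘ n = l ∘ e1 ∘ e2 ∘ e3).
    { apply (product_ext hq); rewrite !comp_assoc.
      - now rewrite sq1, <- comp_assoc, n1, !comp_assoc, hx, kl.
      - now rewrite sq2, <- comp_assoc, n2. }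
    apply (regular_epi_epic he1), (regular_epi_epic he2), (regular_epi_epic he3).
    rewrite <- !(comp_assoc s), <- fm, <- fn, !comp_assoc, st.
    now rewrite <- !comp_assoc, m1, n1. }
  exists h; split.
  - split; [exact hh|].
    apply ep; now rewrite <- comp_assoc, <- sq1, comp_assoc, hh.
  - intros h' [h1 _]; apply (regular_epi_epic eq1); congruence.
Qed.

End Coextensivity.

Theorem proposition5p2 (C : Category) :
  pre_exact C -> majority C ->
  forall X : C, global_support X -> projection_coextensive X.
Proof.
  intros preC majC X gX.
  pose proof (proj1 preC) as regC.
  assert (epi : forall (Z A A' : C) (p : hom Z A) (p' : hom Z A'),
      global_support Z -> is_product p p' -> regular_epi p).
  { intros Z A A' p p' gZ hp; exact (projection_regular_epi regC gZ hp). }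
  assert (quot : forall (A A' : C) (p : hom X A) (p' : hom X A'),
      is_product p p' -> global_support A).
  { intros A A' p p' hp.
    exact (global_support_epic (regular_epi_epic (epi _ _ _ _ _ gX hp)) gX). }
  split.
  - intros Y A f p (Y' & f' & hf) (A' & p' & hp).
    destruct (projection_pushout_exists preC majC gX hf hp) as (P & u & v & po).
    exists P, u, v; split; [exact po|]; split.
    (* The complement of [u] is the leg [u'] of the pushout of [f] along the complementary
       projection [p']; for [v], the roles of [f] and [p] are exchanged. *)
    + destruct (projection_pushout_exists preC majC gX hf (product_swap hp))
        as (P' & u' & v' & po').
      exists P', u'; exact (pushout_product preC majC gX hf hp po po').
    + destruct (projection_pushout_exists preC majC gX hp (product_swap hf))
        as (P' & v' & u' & po').
      exists P', v'.
      exact (pushout_product preC majC gX hp hf (pushout_swap po) po').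
  - intros A1 A2 Y B1 B2 p1 p2 q1 q2 a1 f a2 hp M1 Mf M2 sq1 sq2.
    pose proof Mf as (Y' & f' & hf).
    split.
    + intros hq.
      pose proof (product_swap hp) as hp'; pose proof (product_swap hq) as hq'.
      pose proof (quot _ _ _ _ hf) as gY.
      assert (ea1 : regular_epi a1).
      { destruct M1 as (B & b & hb); exact (epi _ _ _ _ _ (quot _ _ _ _ hp) hb). }
      assert (ea2 : regular_epi a2).
      { destruct M2 as (B & b & hb); exact (epi _ _ _ _ _ (quot _ _ _ _ hp') hb). }
      split; split.
      * exact (product_pushout regC hp hq
          (regular_epi_epic (epi _ _ _ _ _ gX hp)) (epi _ _ _ _ _ gY hq)
          ea1 ea2 sq1 sq2).
      * split; [now exists B2, q2 | exact M1].
      * exact (product_pushout regC hp' hq'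
          (regular_epi_epic (epi _ _ _ _ _ gX hp')) (epi _ _ _ _ _ gY hq')
          ea2 ea1 sq2 sq1).
      * split; [now exists B1, q1 | exact M2].
    + intros [[po1 _] [po2 _]].
      exact (pushout_product preC majC gX hf hp po1 po2).
Qed.
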